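(* Let $R$ be an arbitrary ring, let $n\geq 1$ be an integer, and let $L$ and $M$ be uniserial left $R$-modules, both of finite length $n$. The following are equivalent: (i) $L$ is isomorphic to $M$. (ii) There exist two $R$-module morphisms $f: L\to M$, $g: M\to L$ and a nonzero element $x\in L$ such that $(g\circ f)(x)=x$. (iii) There exist $n$ $R$-module morphisms $f_1, \ldots , f_n$, where $f_i: L\to M$ for $i$ odd and $f_i: M\to L$ for $i$ even, such that $f_n\circ \cdots \circ f_1\neq 0$.
   Context: Rings are associative with identity, and modules are left modules. A module is uniserial if its lattice of submodules is a chain (totally ordered by inclusion). The length of a module of finite length is its composition length. *)

(* Defs.v *)
From HB Require Import structures.
From mathcomp Require Import all_boot all_order all_algebra.
From mathcomp Require Import boolp classical_sets.

Set Implicit Arguments.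
Unset Strict Implicit.
Unset Printing Implicit Defensive.

Import GRing.Theory.
Local Open Scope classical_set_scope.
Local Open Scope ring_scope.

Definition submodule (R : pzRingType) (V : lmodType R) (A : set V) : Prop :=
  submod_closed [in A].

Definition uniserial (R : pzRingType) (V : lmodType R) : Prop :=
  forall A B : set V, submodule A -> submodule B -> A `<=` B \/ B `<=` A.

(* [C i.+1 / C i] is simple, expressed through the submodules of [V] lying
   between [C i] and [C i.+1]. Only the values [C 0, ..., C n] matter. *)
Definition composition_series (R : pzRingType) (V : lmodType R) (n : nat)
    (C : nat -> set V) : Prop :=
  [/\ C 0%N = [set 0],
      C n = setT,
      forall i, (i <= n)%N -> submodule (C i) &
      forall i, (i < n)%N -> C i `<` C i.+1 /\
        forall A : set V, submodule A -> C i `<=` A -> A `<=` C i.+1 ->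
          A = C i \/ A = C i.+1].

Definition has_length (R : pzRingType) (V : lmodType R) (n : nat) : Prop :=
  exists C : nat -> set V, composition_series n C.

Definition isomorphic (R : pzRingType) (L M : lmodType R) : Prop :=
  exists f : {linear L -> M}, bijective f.

(* The alternating sequence of modules L, M, L, M, ... *)
Definition altmod (R : pzRingType) (L M : lmodType R) (i : nat) : lmodType R :=
  if odd i then M else L.

(* With [f i] standing for the morphism f_(i+1), so that f_j : L -> M for j odd
   and f_j : M -> L for j even, this is the composite f_n o ... o f_1. *)
Fixpoint altcomp (R : pzRingType) (L M : lmodType R) (n : nat) :
    (forall i : 'I_n, {linear altmod L M i -> altmod L M i.+1}) ->
    L -> altmod L M n :=
  match n with
  | 0 => fun _ x => x
  | m.+1 => fun f x =>
      f ord_max (altcomp (fun i : 'I_m => f (widen_ord (leqnSn m) i)) x)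
  end.

(* Main.v *)
(** If L and M are not isomorphic, no morphism between them is injective, since
    an injective morphism between uniserial modules of equal finite length is
    onto. A non-injective morphism lowers the levels of the composition series:
    it maps the k+1-st term of one into the k-th term of the other. Hence an
    alternating composite of n morphisms sends the n-th term, which is all of
    L, into the 0-th, which is zero. *)
Require Import Defs.
From HB Require Import structures.
From mathcomp Require Import all_boot all_order all_algebra.
From mathcomp Require Import boolp classical_sets.

Set Implicit Arguments.
Unset Strict Implicit.
Unset Printing Implicit Defensive.

Import GRing.Theory.
Local Open Scope ring_scope.

Lemma submoduleP (R : pzRingType) (V : lmodType R) (A : set V) :
  submodule A <-> A 0 /\ forall a u v, A u -> A v -> A (a *: u + v).
Proof.
split=> [[A0 AD]|[A0 AD]].
  split=> [|a u v Au Av]; first exact: set_mem A0.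
  by apply: set_mem; apply: AD; apply: mem_set.
split=> [|a u v /set_mem Au /set_mem Av]; first exact: mem_set.
by apply: mem_set; apply: AD.
Qed.

Section Morphisms.
Local Open Scope classical_set_scope.
Variables (R : pzRingType) (L M : lmodType R).
Implicit Types (f : {linear L -> M}) (A : set L) (B : set M).

Lemma submodule_image f A : submodule A -> submodule (f @` A).
Proof.
move=> /submoduleP[A0 AD]; apply/submoduleP; split.
  by exists 0; rewrite ?linear0.
move=> a _ _ [u Au <-] [v Av <-]; exists (a *: u + v); first exact: AD.
by rewrite linearP.
Qed.

Lemma submodule_preimage f B : submodule B -> submodule (f @^-1` B).
Proof.
move=> /submoduleP[B0 BD]; apply/submoduleP; split; first by rewrite /= linear0.
by move=> a u v Bu Bv; rewrite /= linearP; apply: BD.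
Qed.

Lemma submoduleI (A A' : set L) :
  submodule A -> submodule A' -> submodule (A `&` A').
Proof.
move=> /submoduleP[A0 AD] /submoduleP[A'0 A'D]; apply/submoduleP; split=> //.
by move=> a u v [Au A'u] [Av A'v]; split; [apply: AD | apply: A'D].
Qed.

(** [bijective] yields a bare function as inverse; cancelling the injective [f] shows that it is
    linear. *)
Lemma linear_inverse f : bijective f ->
  exists g : {linear M -> L}, cancel f g /\ cancel g f.
Proof.
case=> g fK gK.
have g_lin : linear g.
  by move=> a u v; apply: (can_inj fK); rewrite linearP !gK.
pose gL := GRing.isLinear.Build R M L *:%R g g_lin.
by exists (HB.pack g gL : {linear M -> L}).
Qed.

Lemma isomorphic_sym : isomorphic L M -> isomorphic M L.
Proof. by case=> f /linear_inverse[g [fK gK]]; exists g, f. Qed.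

Lemma has_length_nonzero n : (0 < n)%N -> has_length L n ->
  exists x : L, x <> 0.
Proof.
move=> n_gt0 [C [C0 _ Csub Cstep]]; have [[_ nCS] _] := Cstep 0%N n_gt0.
apply: contrapT => /forallNP L0; apply: nCS => x _.
by rewrite (contrapT (L0 x)); have /submoduleP[] := Csub 0%N isT.
Qed.

Variables (n : nat) (C : nat -> set L) (D : nat -> set M).
Hypothesis uM : uniserial M.
Hypotheses (serC : composition_series n C) (serD : composition_series n D).

Lemma injective_isomorphic f : injective f -> isomorphic L M.
Proof.
case: serC => C0 Cn Csub Cstep; case: serD => D0 Dn Dsub Dstep f_inj.
have DfC k : (k <= n)%N -> D k `<=` f @` C k.
  elim: k => [_|k IHk ltkn].
    by rewrite D0 C0 => _ ->; exists 0; rewrite ?linear0.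
  have [[CS nCS] _] := Cstep k ltkn; have [[DS nDS] Dmax] := Dstep k ltkn.
  have fCsub : submodule (f @` C k.+1) by exact/submodule_image/Csub.
  have [//|fCD] := uM (Dsub _ ltkn) fCsub.
  have DfC : D k `<=` f @` C k := IHk (ltnW ltkn).
  have DfCS : D k `<=` f @` C k.+1 by apply: subset_trans DfC (image_subset CS).
  have [fCDk|->//] := Dmax _ fCsub DfCS fCD.
  case: nCS => x Cx; have /DfC[y Cy /f_inj <-//] : D k (f x).
  by rewrite -fCDk; exists x.
have f_surj y : exists x, f x = y.
  have [|x _ <-] := DfC n (leqnn n) y; first by rewrite Dn.
  by exists x.
have [g gK] := choice f_surj.
by exists f, g => // x; apply: f_inj; rewrite gK.
Qed.

Hypothesis uL : uniserial L.

Lemma noninjective_shift f k : ~ injective f -> (k < n)%N ->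
  f @` C k.+1 `<=` D k.
Proof.
case: serC => C0 Cn Csub Cstep; case: serD => D0 Dn Dsub Dstep f_ninj.
elim: k => [|k IHk] ltkn.
  have [_ Cmax] := Cstep 0%N ltkn.
  (* Base case: the kernel is comparable with the simple submodule [C 1], and being nonzero it
     contains [C 1]. *)
  have kerD0 : f @^-1` D 0%N = [set x | f x = 0] by rewrite D0.
  have kersub : submodule (f @^-1` D 0%N) by exact/submodule_preimage/Dsub.
  have [Cker|kerC] := uL (Csub _ ltkn) kersub.
    by move=> _ [x /Cker fx <-].
  have C0ker : C 0%N `<=` f @^-1` D 0%N.
    by rewrite C0 kerD0 => _ -> /=; rewrite linear0.
  have [ker0|ker1] := Cmax _ kersub C0ker kerC.
    case: f_ninj; apply: raddf_inj => x fx.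
    suff : C 0%N x by rewrite C0.
    by rewrite -ker0 kerD0.
  by move=> _ [x Cx <-]; move: Cx; rewrite -ker1.
have ltkn' := ltnW ltkn; have {}IHk := IHk ltkn'.
have [[DS nDS] _] := Dstep k ltkn'; have [[CS nCS] Cmax] := Cstep k.+1 ltkn.
have Csub2 := Csub _ ltkn; have Dsub1 := Dsub _ ltkn'.
have [//|DfC] := uM (submodule_image f Csub2) Dsub1.
have Asub := submoduleI Csub2 (submodule_preimage f Dsub1).
have CA : C k.+1 `<=` C k.+2 `&` f @^-1` D k.+1.
  by move=> x Cx; split; [exact: CS | apply/DS/IHk; exists x].
have [AC|AC] := Cmax _ Asub CA (@subIsetl _ _ _).
  case: nDS => y Dy; have [x Cx fxy] := DfC y Dy.
  by apply: IHk; exists x => //; rewrite -AC; split; rewrite //= fxy.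
by move=> _ [x Cx <-]; move: Cx; rewrite -AC => -[].
Qed.

End Morphisms.

Section Alternating.
Variables (R : pzRingType) (L M : lmodType R).

(** The [return] clause typechecks because [odd i.+1] computes to [~~ odd i]. *)
Definition alt_morphism (f : {linear L -> M}) (g : {linear M -> L}) i :
    {linear altmod L M i -> altmod L M i.+1} :=
  match odd i as b
    return {linear (if b then M else L) -> if ~~ b then M else L} with
  | true => g
  | false => f
  end.

Definition alt_point (x : L) (y : M) i : altmod L M i :=
  match odd i as b return (if b then M else L : lmodType R) with
  | true => y
  | false => x
  end.

Lemma altcomp_point (f : {linear L -> M}) (g : {linear M -> L}) (x : L) m :
  g (f x) = x ->
  altcomp (fun i : 'I_m => alt_morphism f g i) x = alt_point x (f x) m.
Proof.
move=> gfx; elim: m => //= m ->.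
by rewrite /alt_morphism /alt_point /altmod /=; case: (odd m).
Qed.

Lemma altmod_step i : isomorphic (altmod L M i) (altmod L M i.+1) ->
  isomorphic L M.
Proof. by rewrite /altmod /=; case: odd => //=; exact: isomorphic_sym. Qed.

Variables (n : nat).
Hypotheses (uL : uniserial L) (uM : uniserial M).
Hypotheses (lL : has_length L n) (lM : has_length M n).

Lemma altmod_uniserial i : uniserial (altmod L M i).
Proof. by rewrite /altmod; case: odd. Qed.

Lemma altmod_length i : has_length (altmod L M i) n.
Proof. by rewrite /altmod; case: odd. Qed.

Lemma altcomp_eq0 (f : forall i : 'I_n, {linear altmod L M i -> altmod L M i.+1}) :
  ~ isomorphic L M -> altcomp f = fun=> 0.
Proof.
(* The series are chosen index by index and may differ on equal modules; the shift lemma accepts any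
   two series. *)
move=> nLM; pose C i := sval (cid (altmod_length i)).
have serC i : composition_series n (C i) := svalP (cid (altmod_length i)).
(* Generalized for induction: after [m] maps the level has dropped from [n] to [j = n - m]. *)
have shift m j (h : forall i : 'I_m, {linear altmod L M i -> altmod L M i.+1}) x :
    (m + j)%N = n -> C m j (altcomp h x).
  elim: m j h => [|m IHm] j h mjn /=.
    by have [_ Cn _ _] := serC 0%N; rewrite -mjn in Cn; rewrite Cn.
  set x' := altcomp _ x.
  have Cx' : C m j.+1 x' by apply: IHm; rewrite addnS -addSn.
  have ltjn : (j < n)%N by rewrite -mjn addSn ltnS leq_addl.
  have ninj : ~ injective (h ord_max).
    move=> /(injective_isomorphic (@altmod_uniserial m.+1) (serC m) (serC m.+1)).
    by move/altmod_step.
  have := noninjective_shift (@altmod_uniserial m.+1) (serC m) (serC m.+1)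
    (@altmod_uniserial m) ninj ltjn.
  by apply; exists x'.
apply/funext => x; have := shift n 0%N f x (addn0 n).
by have [-> _ _ _] := serC n.
Qed.

End Alternating.

Theorem corollary2p3 (R : pzRingType) (n : nat) (hn : (1 <= n)%N)
    (L M : lmodType R)
    (uL : uniserial L) (uM : uniserial M)
    (lL : has_length L n) (lM : has_length M n) :
  [<-> (* (i) *)
       isomorphic L M;
       (* (ii) *)
       exists (f : {linear L -> M}) (g : {linear M -> L}) (x : L),
         x <> 0 /\ (g \o f) x = x;
       (* (iii) *)
       exists f : forall i : 'I_n, {linear altmod L M i -> altmod L M i.+1},
         altcomp f <> (fun=> 0)].
Proof.
tfae.
- case=> f /linear_inverse[g [fK _]].
  by have [x x0] := has_length_nonzero hn lL; exists f, g, x; split; last exact: fK.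
(* Alternating [f] and [g] moves [x] to [f x] and back, and [f x] is nonzero since [g] sends it to
   [x]. *)
- case=> f [g [x [x0 /= gfx]]]; exists (alt_morphism f g).
  move=> /(congr1 (fun h => h x)); rewrite (altcomp_point _ gfx).
  rewrite /alt_point /altmod; case: (odd n) => //.
  by move=> fx0; apply: x0; rewrite -gfx fx0 linear0.
- by case=> f f0; apply: contrapT => /(altcomp_eq0 uL uM lL lM f).
Qed.
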